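(* Let $\mathfrak{g}$ and $V$ be vector spaces over $\mathbf{k}$, and let $\mu_\mathfrak{g} \in \mathrm{Hom}(\mathfrak{g}^{\otimes 2}, \mathfrak{g})$, $l_V \in \mathrm{Hom}(\mathfrak{g} \otimes V, V)$, $r_V \in \mathrm{Hom}(V \otimes \mathfrak{g}, V)$ and $R \in \mathrm{Hom}(V, \mathfrak{g})$ be linear maps. Put $\pi = \mu_\mathfrak{g} + l_V + r_V \in (L')_1$. Then $V \xrightarrow{R} \mathfrak{g}$ is an rRB Leibniz algebra (that is, $(\mathfrak{g}, \mu_\mathfrak{g})$ is a Leibniz algebra, $(V, l_V, r_V)$ is a representation of it, and $R$ is a relative Rota-Baxter operator) if and only if $\theta = (\pi[1], R) \in (L'[1] \oplus \mathfrak{a})_0$ is a Maurer-Cartan element in the $L_\infty$-algebra $(L'[1] \oplus \mathfrak{a}, \{l_k\}_{k \geq 1})$.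
   Context: $\mathbf{k}$ is a field of characteristic $0$; vector spaces, linear maps and tensor products are over $\mathbf{k}$. Leibniz algebra: a vector space $\mathfrak{g}$ with a linear map $[~,~]_\mathfrak{g} = \mu_\mathfrak{g} : \mathfrak{g}\otimes\mathfrak{g}\to\mathfrak{g}$ satisfying $[x,[y,z]_\mathfrak{g}]_\mathfrak{g} = [[x,y]_\mathfrak{g},z]_\mathfrak{g} + [y,[x,z]_\mathfrak{g}]_\mathfrak{g}$. A representation of $\mathfrak{g}$ is a vector space $V$ with linear maps $l_V : \mathfrak{g}\otimes V\to V$, $r_V : V\otimes\mathfrak{g}\to V$ such that for all $x,y\in\mathfrak{g}$, $v\in V$: $l_V(x,l_V(y,v)) = l_V([x,y]_\mathfrak{g},v)+l_V(y,l_V(x,v))$; $l_V(x,r_V(v,y)) = r_V(l_V(x,v),y)+r_V(v,[x,y]_\mathfrak{g})$; $r_V(v,[x,y]_\mathfrak{g}) = r_V(r_V(v,x),y)+l_V(x,r_V(v,y))$. A relative Rota-Baxter operator is a linear map $R:V\to\mathfrak{g}$ with $[R(v),R(v')]_\mathfrak{g} = R(l_V(R(v),v')+r_V(v,R(v')))$ for all $v,v'\in V$. Balavoine bracket: for a vector space $E$, let $C^n(E,E)=\mathrm{Hom}(E^{\otimes n},E)$, and let $C^{\bullet+1}(E,E)=\oplus_{n\ge 0}C^{n+1}(E,E)$ with $C^{n+1}(E,E)$ in degree $n$. It is a graded Lie algebra with the degree $0$ bracket $[f,g]_\mathsf{B} = f\diamond g-(-1)^{mn}g\diamond f$ for $f\in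 C^{m+1}(E,E)$, $g\in C^{n+1}(E,E)$, where $$(f\diamond g)(x_1,\ldots,x_{m+n+1}) = \sum_{i=1}^{m+1}(-1)^{(i-1)n}\sum_{\sigma\in Sh(i-1,n)}(-1)^\sigma f(x_{\sigma(1)},\ldots,x_{\sigma(i-1)},g(x_{\sigma(i)},\ldots,x_{\sigma(i+n-1)},x_{i+n}),x_{i+n+1},\ldots,x_{m+n+1}),$$ $(-1)^\sigma$ is the sign of $\sigma$, and $Sh(i,j)$ is the set of $\sigma\in S_{i+j}$ with $\sigma(1)<\cdots<\sigma(i)$ and $\sigma(i+1)<\cdots<\sigma(i+j)$. Bidegree: let $\mathfrak{g}^{k,l}\subset(\mathfrak{g}\oplus V)^{\otimes k+l}$ be the direct sum of all tensor products of $k$ copies of $\mathfrak{g}$ and $l$ copies of $V$ in all orders (zero if $k<0$ or $l<0$). For $k,l\ge -1$ with $k+l=n\geq 0$, $C^{k|l}(\mathfrak{g}\oplus V,\mathfrak{g}\oplus V)$ is the space of $f\in\mathrm{Hom}((\mathfrak{g}\oplus V)^{\otimes n+1},\mathfrak{g}\oplus V)$ with $f(\mathfrak{g}^{k+1,l})\subset\mathfrak{g}$, $f(\mathfrak{g}^{k,l+1})\subset V$ and $f=0$ on the other summands. Maps defined on a tensor product of copies of $\mathfrak{g}$ and $V$ with values in $\mathfrak{g}$ or $V$ are identified with maps on $(\mathfrak{g}\oplus V)^{\otimes n}$ by extension by zero (horizontal lift). Let $L=(C^{\bullet+1}(\mathfrak{g}\oplus V,\mathfrak{g}\oplus V),[~,~]_\mathsf{B})$,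 $L'=\oplus_{k\ge0}C^{k|0}(\mathfrak{g}\oplus V,\mathfrak{g}\oplus V)$ ($C^{k|0}$ in degree $k$; a graded Lie subalgebra), $\mathfrak{a}=\oplus_{l\ge 0}C^{-1|l+1}(\mathfrak{g}\oplus V,\mathfrak{g}\oplus V)\cong\oplus_{l\ge0}\mathrm{Hom}(V^{\otimes l+1},\mathfrak{g})$ ($C^{-1|l+1}$ in degree $l$; an abelian subalgebra), and let $P:L\to L$ be the projection onto $\mathfrak{a}$ that vanishes on all $C^{k|l}$ with $k\ge 0$. The graded space $L'[1]\oplus\mathfrak{a}$ has $(L'[1]\oplus\mathfrak{a})_i=L'_{i+1}\oplus\mathfrak{a}_i$; write $x[1]$ for $x\in L'$ viewed in $L'[1]$. In particular $(L'[1]\oplus\mathfrak{a})_0=\mathrm{Hom}(\mathfrak{g}^{\otimes2},\mathfrak{g})\oplus\mathrm{Hom}(\mathfrak{g}^{1,1},V)\oplus\mathrm{Hom}(V,\mathfrak{g})$, with $\mathfrak{g}^{1,1}=(\mathfrak{g}\otimes V)\oplus(V\otimes\mathfrak{g})$. $L_\infty$-algebras are in the degree-shifted convention: graded symmetric degree $1$ maps $l_k$ satisfying $\sum_{i+j=n+1}\sum_{\sigma\in Sh(i,n-i)}\epsilon(\sigma)\,l_j(l_i(x_{\sigma(1)},\ldots,x_{\sigma(i)}),x_{\sigma(i+1)},\ldots,x_{\sigma(n)})=0$ for all $n\ge1$ ($\epsilon(\sigma)$ the Koszul sign). The $L_\infty$-structure on $L'[1]\oplus\mathfrak{a}$ is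 given by $l_2(q[1],q'[1])=(-1)^{|q|}[q,q']_\mathsf{B}[1]$ and $l_k(q[1],a_1,\ldots,a_{k-1})=P[\cdots[[q,a_1]_\mathsf{B},a_2]_\mathsf{B},\ldots,a_{k-1}]_\mathsf{B}$ for $k\ge2$ (homogeneous $q,q'\in L'$, $a_i\in\mathfrak{a}$), all other components vanishing up to permutation of entries. A Maurer-Cartan element is a degree $0$ element $\theta$ with $\sum_{k\ge1}\frac1{k!}l_k(\theta,\ldots,\theta)=0$ (for degree $0$ elements of this $L_\infty$-algebra only finitely many terms are nonzero). *)

(* Defs.v *)
From HB Require Import structures.
From mathcomp Require Import all_boot all_order all_fingroup all_algebra.
From mathcomp Require Import boolp functions.

Set Implicit Arguments.
Unset Strict Implicit.
Unset Printing Implicit Defensive.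

Import GRing.Theory.
Local Open Scope ring_scope.

(* Hom(A^{(x) n}, B) is represented by n-ary multilinear maps, and these by     *)
(* functions on lists that vanish off the lists of size n.  In this way the     *)
(* direct sum of all the Hom(E^{(x) n+1}, E) lives in the single vector space   *)
(* seq E -> E (with the pointwise operations): the component of arity n + 1 is  *)
(* the restriction to the lists of size n + 1.                                  *)
Definition cochain (k : fieldType) (A B : lmodType k) (n : nat)
    (f : seq A -> B) : Prop :=
  (forall s, size s != n -> f s = 0) /\
  (forall s1 s2, (size s1 + size s2).+1 = n ->
     linear (fun x : A => f (s1 ++ x :: s2))).

Section Balavoine.
Variables (k : fieldType) (E : lmodType k).
Implicit Types F G : seq E -> E.

Definition shuffle (i j : nat) (s : 'S_(i + j)) : bool :=
  [forall a : 'I_i, forall b : 'I_i,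
     (a < b)%N ==> (s (lshift j a) < s (lshift j b))%N] &&
  [forall a : 'I_j, forall b : 'I_j,
     (a < b)%N ==> (s (rshift i a) < s (rshift i b))%N].

(* F has degree m (arity m + 1) and G has degree n; indices start from 0, so    *)
(* that i, xs`_j below are i - 1, x_{j+1} in the usual formula.                 *)
Definition diamond (m n : nat) F G : seq E -> E := fun xs =>
  if size xs == (m + n).+1 then
    \sum_(i < m.+1) (-1) ^+ (i * n) *:
      \sum_(s : 'S_(i + n) | shuffle s) (-1) ^+ s *:
        F ([seq xs`_(s (lshift n j)) | j <- enum 'I_i]
           ++ G (rcons [seq xs`_(s (rshift i j)) | j <- enum 'I_n] xs`_(i + n))
           :: drop (i + n).+1 xs)
  else 0.

Definition balavoine_homog (m n : nat) F G : seq E -> E :=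
  diamond m n F G - (-1) ^+ (m * n) *: diamond n m G F.

(* Bilinear extension to the direct sum of the homogeneous components: the      *)
(* component of degree N is the sum of the brackets of the components of F and  *)
(* G of degrees m and n with m + n = N.                                         *)
Definition balavoine F G : seq E -> E := fun xs =>
  \sum_(n < size xs) balavoine_homog ((size xs).-1 - n) n F G xs.

Lemma cochain_slot0 m F s1 s2 :
  cochain m.+1 F -> F (s1 ++ 0 :: s2) = 0.
Proof.
move=> [F0 Flin].
have [sz|sz] := eqVneq (size s1 + size s2).+1 m.+1; last first.
  by apply: F0; rewrite size_cat /= addnS.
have := Flin _ _ sz (-1) 0 0.
by rewrite scaler0 addr0 scaleN1r addNr.
Qed.

Lemma diamond_eq0 m n m' n' F G : cochain m.+1 F -> cochain n.+1 G ->
  (m' != m) || (n' != n) -> diamond m' n' F G = 0.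
Proof.
move=> cF cG neq; apply/funext => xs; rewrite /diamond.
case: eqP => [szx|//]; apply: big1 => i _.
rewrite big1 ?scaler0// => s _.
have [/eqP n'n|n'n] := boolP (n' == n); last first.
  rewrite (cG.1 (rcons _ _)) ?(cochain_slot0 _ _ cF) ?scaler0//.
  by rewrite size_rcons size_map size_enum_ord eqSS.
rewrite cF.1 ?scaler0// size_cat /= size_map size_enum_ord size_drop szx.
move: neq; rewrite n'n eqxx orbF => /negPf m'm.
have im : (i <= m')%N by rewrite -ltnS.
suff -> : (i + ((m' + n).+1 - (i + n).+1).+1 = m'.+1)%N by rewrite eqSS m'm.
by rewrite subSS subnDr addnS subnKC.
Qed.

Lemma balavoineE (m n : nat) F G : cochain m.+1 F -> cochain n.+1 G ->
  balavoine F G = balavoine_homog m n F G.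
Proof.
move=> cF cG; apply/funext => xs.
have Z p q : (p != m) || (q != n) -> balavoine_homog p q F G xs = 0.
  move=> neq; rewrite /balavoine_homog (diamond_eq0 cF cG)//.
  by rewrite (diamond_eq0 cG cF) 1?orbC// scaler0 subr0.
rewrite /balavoine.
have [szx|szx] := eqVneq (size xs) (m + n).+1.
  have n_lt : (n < size xs)%N by rewrite szx ltnS leq_addl.
  rewrite (bigD1 (Ordinal n_lt))//= big1 ?addr0.
    by rewrite szx /= addnK.
  by move=> j jn; apply: Z; apply/orP; right.
have -> : balavoine_homog m n F G xs = 0.
  transitivity (diamond m n F G xs - (-1) ^+ (m * n) *: diamond n m G F xs).
    by [].
  by rewrite /diamond [(n + m)%N]addnC (negPf szx) scaler0 subr0.
apply: big1 => j _; apply: Z.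
case: eqP => //= e; apply: contra szx => /eqP jn.
case: (size xs) j jn e => [[//]|N] j jn /= e.
by rewrite eqSS -e -jn subnK// -ltnS.
Qed.

End Balavoine.

Section Bidegree.
Variables (k : fieldType) (g V : lmodType k).
Local Notation E := (g * V)%type.
Local Notation L := (seq E -> E).

Definition summand (x : g + V) : E :=
  match x with inl a => (a, 0) | inr v => (0, v) end.

Definition count_g (w : seq (g + V)) : nat :=
  count (fun x => if x is inl _ then true else false) w.

(* C^{p|q}, for p, q >= -1 (with p + q >= 0).  A word w with count_g w = a and  *)
(* size w = p + q + 1 gives a pure tensor of g^{a, p + q + 1 - a}.              *)
Definition bidegree (p q : int) (f : L) : Prop :=
  exists2 n : nat, p + q = n%:Z &
    cochain n.+1 f /\
    forall w : seq (g + V), size w = n.+1 ->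
      let fw := f (map summand w) in
      if (count_g w)%:Z == p + 1 then fw.2 = 0
      else if (count_g w)%:Z == p then fw.1 = 0
      else fw = 0.

Definition Lprime (i : int) (f : L) : Prop :=
  if i is Posz p then bidegree p 0 f else f = 0.

Definition afrak (i : int) (f : L) : Prop :=
  if i is Posz l then bidegree (-1) l.+1 f else f = 0.

Definition Pproj (f : L) : L := fun xs => ((f [seq (0, x.2) | x <- xs]).1, 0).

Lemma cochain_ext (n : nat) (f h : L) : cochain n f -> cochain n h ->
  (forall w, size w = n -> f (map summand w) = h (map summand w)) -> f = h.
Proof.
move=> [f0 flin] [h0 hlin] fh; apply/funext => xs.
have [szx|szx] := eqVneq (size xs) n; last by rewrite f0 ?h0.
suff gen (s : seq E) w : (size w + size s)%N = n ->
    f (map summand w ++ s) = h (map summand w ++ s).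
  by rewrite -[xs]cat0s -[[::]]/(map summand [::]) gen.
elim: s w => [|x s IH] w /= sz; first by rewrite cats0 fh// -sz addn0.
have -> : x = 1 *: summand (inl x.1) + summand (inr x.2).
  by rewrite scale1r; case: x => a b; congr pair; rewrite /= ?addr0 ?add0r.
have sz' : (size (map summand w) + size s).+1 = n.
  by rewrite size_map -addnS.
rewrite flin// hlin//.
have step y : f (map summand w ++ summand y :: s) =
              h (map summand w ++ summand y :: s).
  by rewrite -cat_rcons -map_rcons IH// size_rcons addSnnS.
by rewrite !step.
Qed.

Lemma Pproj_cochain (n : nat) (f : L) : cochain n f -> cochain n (Pproj f).
Proof.
move=> [f0 flin]; split=> [s sz|s1 s2 sz c x y].
  by rewrite /Pproj f0 ?size_map.
rewrite /Pproj !map_cat /=.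
have -> : (0, c *: x.2 + y.2) = c *: (0, x.2) + (0, y.2) :> E.
  by congr pair; rewrite /= scaler0 addr0.
by rewrite flin ?size_map//; congr pair; rewrite /= scaler0 addr0.
Qed.

Lemma count_g_eq0 (w : seq (g + V)) : count_g w = 0%N ->
  [seq (0, x.2) | x : E <- map summand w] = map summand w.
Proof. by elim: w => //= -[x|v] w IH //= /IH ->. Qed.

Lemma count_g_neq0 (w : seq (g + V)) : count_g w != 0%N ->
  exists w1 a w2, w = w1 ++ inl a :: w2.
Proof.
elim: w => //= -[a|v] w IH => [_|/IH[w1 [a [w2 ->]]]].
  by exists [::], a, w.
by exists (inr v :: w1), a, w2.
Qed.

Lemma Pproj_count_g (n : nat) (f : L) (w : seq (g + V)) : cochain n.+1 f ->
  count_g w != 0%N -> Pproj f (map summand w) = 0.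
Proof.
move=> cf /count_g_neq0[w1 [a [w2 ->]]].
by rewrite /Pproj !map_cat /= (cochain_slot0 _ _ cf).
Qed.

Lemma Pproj_afrak (n : nat) (f : L) : cochain n.+1 f -> afrak n (Pproj f).
Proof.
move=> cf; exists n; first by rewrite intS addrA addNr add0r.
split; first exact: Pproj_cochain.
move=> w szw /=; rewrite addNr; have [//|cw] := eqVneq.
by rewrite (Pproj_count_g cf).
Qed.

Lemma Pproj_id (i : int) (f : L) : afrak i f -> Pproj f = f.
Proof.
case: i => [l [n _ [cf fw]]|l ->]; last by [].
apply: (cochain_ext (Pproj_cochain cf) cf) => w szw.
move: (fw w szw) => /=; rewrite addNr; have [cw f2|cw f0] := eqVneq.
  by case: cw => cw; rewrite /Pproj (count_g_eq0 cw) -f2; case: (f _).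
by rewrite (Pproj_count_g cf)// f0.
Qed.

Lemma Pproj_eq0 (p q : int) (f : L) : 0 <= p -> bidegree p q f -> Pproj f = 0.
Proof.
case: p => // p _ [n _ [cf fw]].
apply: (cochain_ext (Pproj_cochain cf)) => [|w szw].
  split=> [//|s1 s2 _ c x y].
  by transitivity (c *: 0 + 0 : E); rewrite ?scaler0 ?addr0.
pose v := [seq inr x.2 | x : E <- map summand w] : seq (g + V).
have cv : count_g v = 0%N by rewrite /v; elim: (w) => //= -[].
have vE : map summand v = [seq (0, x.2) | x : E <- map summand w].
  by rewrite /v -map_comp.
have szv : size v = n.+1 by rewrite !size_map.
move: (fw v szv) => /=; rewrite cv vE addrC -intS /=.
by rewrite /Pproj; case: eqP => [_ ->|_ ->].
Qed.

(* The pair (q, a) stands for q[1] + a.                                         *)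
Definition shifted_deg (i : int) (x : L * L) : Prop :=
  Lprime (i + 1) x.1 /\ afrak i x.2.

(* l_r on a list of r homogeneous elements, each given with its degree in       *)
(* L'[1] (+) a, so that the component q[1] of an element of degree d has        *)
(* |q| = d + 1.  Since l_r vanishes on r entries of a, and on two or more       *)
(* entries of L'[1] unless r = 2, only two kinds of terms are left: those with  *)
(* a single entry q_j[1], which is moved to the front with its Koszul sign,     *)
(* and, for r = 2, the term l_2(q[1], q'[1]).                                   *)
Definition linf (xs : seq (int * (L * L))) : L * L :=
  let x0 : int * (L * L) := (0, 0) in
  ( if xs is [:: x; y] then
      (-1) ^ (x.1 + 1) *: balavoine x.2.1 y.2.1
    else 0,
    if (2 <= size xs)%N then
      \sum_(j < size xs)
        let x := nth x0 xs j in
        (-1) ^ (x.1 * \sum_(y <- take j xs) y.1) *: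
          Pproj (foldl (@balavoine k E) x.2.1
                   [seq y.2.2 | y <- take j xs ++ drop j.+1 xs])
    else 0 ).

Definition lift_mu (mu : g -> g -> g) : L := fun xs =>
  if xs is [:: x; y] then (mu x.1 y.1, 0) else 0.
Definition lift_l (l : g -> V -> V) : L := fun xs =>
  if xs is [:: x; y] then (0, l x.1 y.2) else 0.
Definition lift_r (r : V -> g -> V) : L := fun xs =>
  if xs is [:: x; y] then (0, r x.2 y.1) else 0.
Definition lift_R (R : V -> g) : L := fun xs =>
  if xs is [:: x] then (R x.2, 0) else 0.

End Bidegree.

Arguments lift_mu {k g} V mu.

(* theta is a degree 0 element with sum_{r >= 1} l_r(theta,..,theta) / r! = 0,  *)
(* the sum having only finitely many nonzero terms.                             *)
Definition maurer_cartan (k : fieldType) (U : lmodType k)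
    (deg : int -> U -> Prop) (l : seq (int * U) -> U) (theta : U) : Prop :=
  deg 0 theta /\
  exists N : nat,
    (forall r, (N <= r)%N -> l (nseq r (0, theta)) = 0) /\
    \sum_(1 <= r < N) (r`!%:R : k)^-1 *: l (nseq r (0, theta)) = 0.

Section RelativeRotaBaxter.
Variables (k : fieldType) (g V : lmodType k).

Definition is_leibniz (mu : g -> g -> g) : Prop :=
  forall x y z, mu x (mu y z) = mu (mu x y) z + mu y (mu x z).

Definition is_representation (mu : g -> g -> g)
    (l : g -> V -> V) (r : V -> g -> V) : Prop :=
  forall (x y : g) (v : V),
    [/\ l x (l y v) = l (mu x y) v + l y (l x v),
        l x (r v y) = r (l x v) y + r v (mu x y) &
        r v (mu x y) = r (r v x) y + l x (r v y)].

Definition is_relative_rota_baxter (mu : g -> g -> g)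
    (l : g -> V -> V) (r : V -> g -> V) (R : V -> g) : Prop :=
  forall v v' : V, mu (R v) (R v') = R (l (R v) v' + r v (R v')).

Definition is_rRB_leibniz (mu : g -> g -> g)
    (l : g -> V -> V) (r : V -> g -> V) (R : V -> g) : Prop :=
  [/\ is_leibniz mu, is_representation mu l r &
      is_relative_rota_baxter mu l r R].

End RelativeRotaBaxter.

(* Main.v *)
(* At the degree 0 element theta = (pi[1], R), only l_2 and l_3 are nonzero.
   The map R has bidegree (-1, 1) as a cochain, so the iterated brackets
   D_n = [..[[pi, R], R].., R] have bidegree (1 - n, n): P kills D_1, D_n = 0
   for n >= 3, and the Maurer-Cartan equation reduces to [pi, pi] = 0 in L' and
   D_2 = 0 in a.  Now [pi, pi] is twice the Leibniz identity for pi, the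
   semidirect product bracket on g (+) V, whose components are the Leibniz
   identity of g and the three axioms of a representation, while D_2 is twice
   the defect of R from being a relative Rota-Baxter operator. *)

Require Import Defs.
From mathcomp Require Import all_boot all_order all_fingroup all_algebra.
From mathcomp Require Import boolp functions.

Import GRing.Theory.
Local Open Scope ring_scope.

(** * Sums over permutations of at most two letters, and their shuffles *)

Lemma big_perm_le1 (W : nmodType) (n : nat) (P : pred 'S_n) (F : 'S_n -> W) :
  (n <= 1)%N -> P 1%g -> \sum_(s | P s) F s = F 1%g.
Proof.
move=> n1 P1; rewrite (big_pred1 1%g)// => s /=.
have -> : s = 1%g.
  apply/permP => a; apply/val_inj; rewrite perm1.
  by case: n n1 {P F P1} s a => [|[|//]] _ s a; [case: a | rewrite !ord1].
by rewrite P1 eqxx.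
Qed.

Lemma big_perm2 (W : nmodType) (P : pred 'S_2) (F : 'S_2 -> W) :
  P 1%g -> P (tperm 0 1) -> \sum_(s | P s) F s = F 1%g + F (tperm 0 1).
Proof.
move=> P1 Pt; rewrite (bigD1 1%g)//= (big_pred1 (tperm 0 1))// => s /=.
apply/idP/eqP => [/andP[_ s1]|->]; last first.
  by rewrite Pt; apply/eqP => /permP/(_ 0); rewrite tpermL perm1.
(* A permutation of two letters that fixes 0 must also fix 1, hence is the identity; so here [s]
   sends 0 to 1. *)
have s0 : s 0 = 1.
  apply/eqP; apply: contraR s1 => s0; apply/eqP/permP.
  have {}s0 : s 0 = 0 by move: s0; case: (s 0) => [[|[|]]]//= *; apply/val_inj.
  have s1 : s 1 != 0 by rewrite -s0 (inj_eq perm_inj).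
  move=> [[|[|//]] i]; rewrite perm1.
    by rewrite (_ : Ordinal i = 0)//; apply/val_inj.
  rewrite (_ : Ordinal i = 1); last exact/val_inj.
  by move: s1; case: (s 1) => [[|[|]]]//= *; apply/val_inj.
have s1' : s 1 != 1 by rewrite -[X in _ != X]s0 (inj_eq perm_inj).
apply/permP => -[[|[|//]] i].
  by rewrite (_ : Ordinal i = 0) ?tpermL//; apply/val_inj.
rewrite (_ : Ordinal i = 1) ?tpermR//; last exact/val_inj.
by move: s1'; case: (s 1) => [[|[|]]]//= *; apply/val_inj.
Qed.

Lemma shuffle_id i j : shuffle (1%g : 'S_(i + j)).
Proof.
by apply/andP; split; apply/forallP => a; apply/forallP => b; apply/implyP;
  rewrite !perm1 //= ltn_add2l.
Qed.

Lemma shuffle_1_1 (s : 'S_(1 + 1)) : shuffle s.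
Proof.
by apply/andP; split; apply/forallP => a; apply/forallP => b; rewrite !ord1.
Qed.

(** * The product [diamond] in low degrees *)

Section Diamond.
Variables (k : fieldType) (E : lmodType k).
Implicit Types F G : seq E -> E.

Lemma diamond10 F G (x y : E) :
  diamond 1 0 F G [:: x; y] = F [:: G [:: x]; y] + F [:: x; G [:: y]].
Proof.
rewrite /diamond /= !big_ord_recl big_ord0 addr0 /=.
rewrite !big_perm_le1 ?shuffle_id//.
rewrite !enum_ordSl !(size0nil (size_enum_ord 0)) /= !perm1 !odd_perm1 /=.
by rewrite !muln0 !expr0 !scale1r.
Qed.

Lemma diamond01 F G (x y : E) :
  diamond 0 1 F G [:: x; y] = F [:: G [:: x; y]].
Proof.
rewrite /diamond /= !big_ord_recl big_ord0 addr0 /=.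
rewrite !big_perm_le1 ?shuffle_id//.
rewrite !enum_ordSl !(size0nil (size_enum_ord 0)) /= !perm1 !odd_perm1 /=.
by rewrite !expr0 !scale1r.
Qed.

Lemma diamond11 F G (x y z : E) :
  diamond 1 1 F G [:: x; y; z] =
    F [:: G [:: x; y]; z] - F [:: x; G [:: y; z]] + F [:: y; G [:: x; z]].
Proof.
rewrite /diamond /= !big_ord_recl big_ord0 addr0 /=.
(* The term i = 0 has one shuffle. The term i = 1 has outer sign -1 and both permutations of two
   letters as shuffles, so the transposition ends up with sign +1. *)
rewrite big_perm_le1 ?shuffle_id// big_perm2 ?shuffle_1_1//.
rewrite !enum_ordSl !(size0nil (size_enum_ord 0)) /= !perm1 !odd_perm1 /=.
have -> : lshift 1 (ord0 : 'I_1) = 0 by apply/val_inj.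
have -> : rshift 1 (ord0 : 'I_1) = 1 by apply/val_inj.
rewrite tpermL tpermR odd_tperm /=.
by rewrite expr0 !scale1r !mul1n !expr1 !scaleN1r opprB addrA addrAC.
Qed.

End Diamond.

(** * The Balavoine bracket on cochains of arity 1 and 2 *)

Section LowArity.
Variables (k : fieldType) (E : lmodType k).
Implicit Types F G : seq E -> E.

Lemma cochain1 F : (forall s, size s != 1 -> F s = 0) ->
  linear (fun x => F [:: x]) -> cochain 1 F.
Proof.
by move=> F0 F1; split=> // -[|? ?] [|? ?] /=; rewrite ?addSn ?addnS.
Qed.

Lemma cochain2 F : (forall s, size s != 2 -> F s = 0) ->
  (forall y, linear (fun x => F [:: x; y])) ->
  (forall x, linear (fun y => F [:: x; y])) -> cochain 2 F.
Proof.
by move=> F0 Fl Fr; split=> // -[|? [|? ?]] [|? [|? ?]] //=;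
  rewrite ?addSn ?addnS.
Qed.

Lemma cochain2_eq0 F : cochain 2 F ->
  (forall x y, F [:: x; y] = 0) -> F = 0.
Proof.
move=> [F0 _] F2; apply/funext => s.
by case: s => [|x [|y [|z s]]]; rewrite ?F2// F0.
Qed.

Lemma balavoine10 F G (x y : E) : cochain 2 F -> cochain 1 G ->
  balavoine F G [:: x; y] =
    F [:: G [:: x]; y] + F [:: x; G [:: y]] - G [:: F [:: x; y]].
Proof.
move=> cF cG; rewrite (balavoineE cF cG) /balavoine_homog.
(* The pointwise operations on functions and the sign $(-1)^{1 \cdot 0}$ unfold by conversion. *)
transitivity (diamond 1 0 F G [:: x; y] - 1 *: diamond 0 1 G F [:: x; y]) => //.
by rewrite scale1r diamond10 diamond01.
Qed.

Lemma cochain_balavoine10 F G :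
  cochain 2 F -> cochain 1 G -> cochain 2 (balavoine F G).
Proof.
move=> cF cG; have Gl := cG.2 [::] [::] erefl; have [_ Fl] := cF.
apply: cochain2 => [s sz|y c u v|x c u v].
- rewrite (balavoineE cF cG) /balavoine_homog.
  transitivity (diamond 1 0 F G s - 1 *: diamond 0 1 G F s) => //.
  by rewrite scale1r /diamond (negPf sz) subr0.
- have Fy z := Fl [::] [:: z] erefl; rewrite /= in Gl Fy.
  rewrite !balavoine10// Gl !Fy Gl !scalerDr scalerN opprD.
  by rewrite [X in X + _ = _]addrACA [LHS]addrACA !addrA.
- have Fx z := Fl [:: z] [::] erefl; rewrite /= in Gl Fx.
  rewrite !balavoine10// Gl !Fx Gl !scalerDr scalerN opprD.
  by rewrite [X in X + _ = _]addrACA [LHS]addrACA !addrA.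
Qed.

(** Two entries of degree 1 contribute the sign $-(-1)^{1 \cdot 1} = 1$, so the two [diamond] terms
    add up instead of cancelling. *)
Lemma balavoine11 F (x y z : E) : cochain 2 F ->
  balavoine F F [:: x; y; z] =
    (F [:: F [:: x; y]; z] - F [:: x; F [:: y; z]] + F [:: y; F [:: x; z]]) *+ 2.
Proof.
move=> cF; rewrite (balavoineE cF cF).
transitivity (diamond 1 1 F F [:: x; y; z] -
              (-1) ^+ 1 *: diamond 1 1 F F [:: x; y; z]) => //.
by rewrite expr1 scaleN1r opprK diamond11 -mulr2n.
Qed.

Lemma balavoine11_size F s : cochain 2 F -> size s != 3 ->
  balavoine F F s = 0.
Proof.
move=> cF sz; rewrite (balavoineE cF cF) /balavoine_homog.
transitivity (diamond 1 1 F F s - (-1) ^+ 1 *: diamond 1 1 F F s) => //.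
by rewrite /diamond (negPf sz) scaler0 subr0.
Qed.

End LowArity.

Arguments cochain2_eq0 {k E F}.

(** * The higher brackets on copies of one element of degree 0 *)

Lemma foldl_nseq (S T : Type) (f : T -> S -> T) (z : T) (a : S) (n : nat) :
  foldl f z (nseq n a) = iter n (f^~ a) z.
Proof. by elim: n z => //= n IH z; rewrite IH -iterSr. Qed.

(** In degree 0 every Koszul sign is 1, so the [r] choices of the entry moved to the front give
    equal terms. The minus sign in the first component is $(-1)^{|q|}$ with $|q| = 1$, because of
    the shift. *)
Lemma linf_nseq0 (k : fieldType) (g V : lmodType k)
    (F T : seq (g * V)%type -> (g * V)%type) (r : nat) :
  linf (nseq r (0, (F, T))) =
    (if r == 2 then - balavoine F F else 0,
     if (2 <= r)%N then Pproj (iter r.-1 (fun G => balavoine G T) F) *+ r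
     else 0).
Proof.
rewrite /linf; congr pair.
  by case: r => [|[|[|r]]] //=; rewrite add0r expr1z scaleN1r.
rewrite size_nseq; case: ifP => // _.
rewrite (eq_bigr (fun=> Pproj (iter r.-1 (fun G => balavoine G T) F))).
  by rewrite sumr_const card_ord.
move=> j _; rewrite nth_nseq ltn_ord /= mul0r expr0z scale1r.
rewrite take_nseq 1?ltnW// drop_nseq.
rewrite -nseqD map_nseq /= foldl_nseq; congr (Pproj (iter _ _ _)).
by case: r j => [[]//|r] j; rewrite subSS subnKC // -ltnS.
Qed.

(** * The iterated brackets of the semidirect product bracket with R *)

Section Theta.
Variables (k : fieldType) (g V : lmodType k).
Variables (mu : {bilinear g -> g -> g}) (l : {bilinear g -> V -> V}).
Variables (r : {bilinear V -> g -> V}) (R : {linear V -> g}).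
Local Notation E := (g * V)%type.
Local Notation pi := (lift_mu V mu + lift_l l + lift_r r).
Local Notation T := (lift_R R).

Lemma lift_bracketE (x y : E) :
  pi [:: x; y] = (mu x.1 y.1, l x.1 y.2 + r x.2 y.1).
Proof.
transitivity ((mu x.1 y.1, 0) + (0, l x.1 y.2) + (0, r x.2 y.1) : E) => //.
by congr pair; rewrite /= ?addr0 ?add0r.
Qed.

Lemma cochain_lift_bracket : cochain 2 pi.
Proof.
apply: cochain2 => [s sz|y c u v|x c u v]; rewrite ?lift_bracketE.
- transitivity (lift_mu V mu s + lift_l l s + lift_r r s : E) => //.
  by case: s sz => [|? [|? [|? ?]]] //= _; rewrite !addr0.
- congr pair; rewrite /= !(linearPl, linearPr)//.
  by rewrite scalerDr addrACA.
- congr pair; rewrite /= !(linearPl, linearPr)//.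
  by rewrite scalerDr addrACA.
Qed.

Lemma cochain_lift_R : cochain 1 T.
Proof.
apply: cochain1 => [[|? []]//|c u v /=].
by rewrite linearP; congr pair; rewrite /= scaler0 addr0.
Qed.

Lemma shifted_deg_theta : shifted_deg 0 (pi, T).
Proof.
(* The witnesses are the total degrees: 1 + 0 for [pi] and -1 + 1 for [T]. *)
split; [exists 1%N => //|exists 0%N => //]; split.
- exact: cochain_lift_bracket.
- move=> [|x [|y []]]// _; rewrite /map [(pi, T).1]/= lift_bracketE.
  case: x => x; case: y => y;
    by rewrite /= ?(linear0l, linear0r) ?addr0.
- exact: cochain_lift_R.
- by move=> [|[] x []]//= _; rewrite linear0.
Qed.

Local Notation D n := (iter n (fun G => balavoine G T) pi).

(** Bracketing with a cochain of arity 1 preserves arity 2, so each [D n] is determined by its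
    values on pairs. *)
Lemma cochain_adR n : cochain 2 (D n).
Proof.
elim: n => [|n IH] /=; first exact: cochain_lift_bracket.
exact: cochain_balavoine10 IH cochain_lift_R.
Qed.

Lemma adRSE n (x y : E) : D n.+1 [:: x; y] =
  D n [:: (R x.2, 0); y] + D n [:: x; (R y.2, 0)] - (R (D n [:: x; y]).2, 0).
Proof.
by rewrite [LHS]balavoine10; [|exact: cochain_adR|exact: cochain_lift_R].
Qed.

Lemma adR1E (x y : E) : D 1 [:: x; y] =
  (mu (R x.2) y.1 + mu x.1 (R y.2) - R (l x.1 y.2 + r x.2 y.1),
   l (R x.2) y.2 + r x.2 (R y.2)).
Proof.
rewrite adRSE [iter 0 _ _]/= !lift_bracketE; congr pair => /=.
by rewrite linear0l linear0r subr0 addr0 add0r.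
Qed.

Lemma adR2E (x y : E) : D 2 [:: x; y] =
  ((mu (R x.2) (R y.2) - R (l (R x.2) y.2 + r x.2 (R y.2))) *+ 2, 0).
Proof.
rewrite adRSE !adR1E; congr pair => /=; last first.
  by rewrite !(linear0, linear0l, linear0r, addr0).
rewrite !(linear0, linear0l, linear0r) !addr0 !add0r linearD.
by rewrite addrACA -opprD mulr2n [RHS]addrA [X in _ = X + _]addrAC.
Qed.

(** [D 2] reads only the V-components of its entries and takes values in g. Bracketing with R either
    feeds it an entry from g or applies R to the V-component of its value, and both give 0. *)
Lemma adR_ge3_eq0 n : D n.+3 = 0.
Proof.
elim: n => [|n IH]; apply: (cochain2_eq0 (cochain_adR _)) => x y.
  rewrite adRSE !adR2E; congr pair => /=; last by rewrite !addr0 subr0.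
  by rewrite !(linear0, linear0l, linear0r, addr0) mul0rn addr0.
rewrite adRSE IH; congr pair => /=; last by rewrite !addr0 subr0.
by rewrite linear0 !addr0 subr0.
Qed.

(** On entries from V the value of [D 1] lies in V, whereas [Pproj] keeps only the g-component. *)
Lemma Pproj_adR1 : Pproj (D 1) = 0.
Proof.
apply: (cochain2_eq0 (Pproj_cochain (cochain_adR 1))) => x y.
rewrite /Pproj [map _ _]/= adR1E /=.
by rewrite !(linear0, linear0l, linear0r, addr0).
Qed.

Lemma rota_baxterP : [pchar k] =i pred0 ->
  is_relative_rota_baxter mu l r R <-> Pproj (D 2) = 0.
Proof.
move=> char0; split=> [RB|D0 u v].
  apply: (cochain2_eq0 (Pproj_cochain (cochain_adR 2))) => x y.
  by rewrite /Pproj [map _ _]/= adR2E /= RB subrr mul0rn.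
move/(congr1 (fun F : seq E -> E => (F [:: (0, u); (0, v)]).1)): D0.
rewrite /Pproj [map _ _]/= adR2E /= => /eqP.
rewrite -scaler_nat scaler_eq0 ((pcharf0P _).1 char0) /= subr_eq0.
by move/eqP.
Qed.

(** * The Leibniz identity of the semidirect product *)

Lemma semidirect_leibnizP :
  is_leibniz mu /\ is_representation mu l r <->
  forall x y z, pi [:: x; pi [:: y; z]] =
                pi [:: pi [:: x; y]; z] + pi [:: y; pi [:: x; z]].
Proof.
split=> [[Lb Rp] x y z|Lb].
  rewrite !lift_bracketE; congr pair => /=; first exact: Lb.
  rewrite !(linearDl, linearDr) /=.
  (* The six terms are paired by which of z, y, x supplies its V-component; each pair is the
     right-hand side of one representation axiom. *)
  rewrite [RHS](GRing.add).[AC ((1*2)*(2*1)) ((1*4)*(2*6)*(3*5))].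
  have [-> _ _] := Rp x.1 y.1 z.2; have [_ -> _] := Rp x.1 z.1 y.2.
  by have [_ _ ->] := Rp y.1 z.1 x.2.
split=> [x y z|x y v].
  by have := congr1 fst (Lb (x, 0) (y, 0) (z, 0)); rewrite !lift_bracketE.
split.
(* Placing the single entry from V in the third, second or first position isolates the corresponding
   axiom. *)
- have := congr1 snd (Lb (x, 0) (y, 0) (0, v)).
  by rewrite !lift_bracketE /= !(linear0, linear0l, linear0r, addr0, add0r).
- have := congr1 snd (Lb (x, 0) (0, v) (y, 0)).
  by rewrite !lift_bracketE /= !(linear0, linear0l, linear0r, addr0, add0r).
- have := congr1 snd (Lb (0, v) (x, 0) (y, 0)).
  by rewrite !lift_bracketE /= !(linear0, linear0l, linear0r, addr0, add0r).
Qed.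

Lemma semidirect_leibniz_balavoineP : [pchar k] =i pred0 ->
  (forall x y z, pi [:: x; pi [:: y; z]] =
                 pi [:: pi [:: x; y]; z] + pi [:: y; pi [:: x; z]]) <->
  balavoine pi pi = 0.
Proof.
move=> char0; split=> [Lb|B0 x y z].
  apply/funext => s; have [sz|sz] := boolP (size s == 3); last first.
    by rewrite balavoine11_size//; exact: cochain_lift_bracket.
  case: s sz => [|x [|y [|z [|? ?]]]]// _.
  rewrite balavoine11; last exact: cochain_lift_bracket.
  by rewrite Lb addrAC subrr mul0rn.
move/(congr1 (fun F : seq E -> E => F [:: x; y; z])): B0 => /eqP.
rewrite balavoine11; last exact: cochain_lift_bracket.
rewrite -scaler_nat scaler_eq0 ((pcharf0P _).1 char0) /=.
by rewrite addrAC subr_eq0 => /eqP.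
Qed.

End Theta.

(** * The Maurer-Cartan sum and the equivalence *)

Lemma big_nat_eventually0 {W : nmodType} {F : nat -> W} {m n : nat} (p : nat) :
  (n <= p)%N -> (forall i, (n <= i)%N -> F i = 0) ->
  \sum_(m <= i < n) F i = \sum_(m <= i < p) F i.
Proof.
move=> np F0; have [mn|nm] := leqP m n; last first.
  rewrite (big_geq (ltnW nm)) big_nat big1 => [//|i /andP[mi _]].
  by apply: F0; exact: leq_trans (ltnW nm) mi.
rewrite [RHS](big_cat_nat mn np) /= [X in _ + X]big_nat.
by rewrite [X in _ + X]big1 ?addr0// => i /andP[ni _]; exact: F0.
Qed.

Theorem theorem3p13 (k : fieldType) (char0 : [pchar k] =i pred0)
    (g V : lmodType k)
    (mu : {bilinear g -> g -> g}) (l : {bilinear g -> V -> V})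
    (r : {bilinear V -> g -> V}) (R : {linear V -> g}) :
  is_rRB_leibniz mu l r R <->
  maurer_cartan (@shifted_deg k g V) (@linf k g V)
    (lift_mu V mu + lift_l l + lift_r r, lift_R R).
Proof.
set pi := lift_mu V mu + _ + _; set T := lift_R R.
have linf_ge4 n : linf (nseq n.+4 (0, (pi, T))) = 0.
  rewrite linf_nseq0 [_.+4.-1]/= adR_ge3_eq0; congr pair.
  by rewrite (_ : Pproj 0 = 0) ?mul0rn.
have n2 : (2%:R : k) != 0 by rewrite ((pcharf0P _).1 char0).
have n3 : (3%:R : k) != 0 by rewrite ((pcharf0P _).1 char0).
(* Bounds of the form [N.+4] ensure that the sum contains all the terms n = 1, 2, 3; the later ones
   vanish. *)
have sumE N : \sum_(1 <= n < N.+4) (n`!%:R : k)^-1 *: linf (nseq n (0, (pi, T)))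
    = (- ((2%:R : k)^-1 *: balavoine pi pi),
       (2%:R : k)^-1 *: Pproj (balavoine (balavoine pi T) T)).
  do 3![rewrite big_ltn//]; rewrite big_nat big1 => [|n]; last first.
    by case: n => [|[|[|[|n]]]]// _; rewrite linf_ge4 scaler0.
  rewrite !linf_nseq0 [_ == _]/= [(2 <= _)%N]/= [_.-1]/= Pproj_adR1 mul0rn.
  (* The three equal terms of $l_3$ cancel the factor 3 of 3!, which leaves the coefficient 1/2. *)
  have -> : (3`!%:R : k)^-1 = 2%:R^-1 * 3%:R^-1 by rewrite -invfM -natrM.
  rewrite !scaler0 add0r addr0.
  congr pair; rewrite /= ?scaler0 ?add0r ?addr0 ?scalerN//.
  by rewrite -scaler_nat !scalerA mulfVK.
have rRB_iff : is_rRB_leibniz mu l r R <->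
    balavoine pi pi = 0 /\ Pproj (balavoine (balavoine pi T) T) = 0.
  have A1 := semidirect_leibnizP _ _ _ mu l r.
  have A2 := semidirect_leibniz_balavoineP _ _ _ mu l r char0.
  have A3 := rota_baxterP _ _ _ mu l r R char0.
  rewrite /is_rRB_leibniz; split=> [[Lb Rp RB]|[/A2/A1[Lb Rp] /A3 RB]] //.
  by split; [apply/A2/A1|apply/A3].
split=> [/rRB_iff[B0 D0]|[_ [N [linfN]]]].
  split; first exact: shifted_deg_theta.
  exists 4; split=> [[|[|[|[|n]]]]// _|].
  by rewrite (sumE 0) B0 D0 !scaler0 oppr0.
(* The given bound [N] may be below 4; since all terms from [N] on vanish, it can be raised to
   [N.+4], where [sumE] applies. *)
rewrite (big_nat_eventually0 N.+4 (leq_addl 4 N)) => [|n Nn]; last first.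
  by rewrite linfN ?scaler0.
rewrite sumE => -[/eqP B0 /eqP D0]; apply/rRB_iff.
move: B0 D0; rewrite oppr_eq0 !scaler_eq0 !invr_eq0 (negPf n2) /=.
by move=> /eqP -> /eqP ->.
Qed.
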